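(* Let $R$ be a commutative noetherian local ring with residue field $k$, let $K$ be the Koszul complex on a minimal generating set for the maximal ideal of $R$, viewed as a dg $R$-algebra, and let $A$ be the group of automorphisms of the $k$-algebra $H(K)$ induced by automorphisms of the dg $R$-algebra $K$. Then the group $A$ is abelian. When $k$ is of positive characteristic $p$, the group $A$ is either trivial or has exponent $p$.
   Context: The Koszul complex $K$ on a minimal generating set $x_1,\dots,x_n$ of the maximal ideal is the exterior algebra over $R$ on a free $R$-module with basis $e_1,\dots,e_n$ placed in degree $1$, with the differential $d$ being the $R$-linear graded derivation of degree $-1$ with $d(e_i)=x_i$. Its homology $H(K)$ is a graded-commutative $k$-algebra. An automorphism of the dg $R$-algebra $K$ is an $R$-linear, degree-preserving algebra automorphism commuting with the differential. The group $A$ consists of the automorphisms $H(\varphi)$ of $H(K)$, with $\varphi$ ranging over all automorphisms of the dg $R$-algebra $K$, under composition. *)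

(* Defs.v *)
From HB Require Import structures.
From mathcomp Require Import all_boot all_order all_algebra.
From mathcomp Require Import boolp ring.

Set Implicit Arguments.
Unset Strict Implicit.
Unset Printing Implicit Defensive.
Import GRing.Theory.
Local Open Scope quotient_scope.
Local Open Scope ring_scope.

(* The exterior algebra over R on a free module with basis e_0, ..., e_(n-1):  *)
(* a : exterior R n stands for \sum_S a S *: e_S, with e_S the product of the  *)
(* e_i for i in S, taken in increasing order of i.                             *)
Definition exterior (R : comNzRingType) (n : nat) : Type :=
  {ffun {set 'I_n} -> R^o}.

HB.instance Definition _ R n := GRing.Lmodule.copy (exterior R n) {ffun {set 'I_n} -> R^o}.

(* e_T * e_U = (-1) ^+ inversions T U *: e_(T :|: U) when T and U are disjoint *)
Definition inversions n (T U : {set 'I_n}) : nat :=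
  \sum_(t in T) \sum_(u in U) (u < t)%N.

Section ExteriorTheory.
Variables (R : comNzRingType) (n : nat).
Implicit Types (a b c : exterior R n) (S T U V W : {set 'I_n}) (i j : 'I_n).

Definition extsign T U : R := (-1) ^+ inversions T U.

Definition extmul a b : exterior R n :=
  [ffun S : {set 'I_n} => \sum_(T : {set 'I_n} | T \subset S) extsign T (S :\: T) * a T * b (S :\: T)].

Definition extbasis T : exterior R n := [ffun S : {set 'I_n} => (S == T)%:R].

Definition extgen i : exterior R n := extbasis [set i].

Lemma extsignUl T U V : [disjoint T & U] ->
  extsign (T :|: U) V = extsign T V * extsign U V.
Proof.
move=> dTU; rewrite /extsign -exprD; congr (_ ^+ _); rewrite /inversions.
by rewrite -bigU //=; apply: eq_bigl => t; rewrite !inE.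
Qed.

Lemma extsignUr T U V : [disjoint U & V] ->
  extsign T (U :|: V) = extsign T U * extsign T V.
Proof.
move=> dUV; rewrite /extsign -exprD; congr (_ ^+ _); rewrite /inversions.
rewrite -big_split; apply: eq_bigr => t _ /=.
by rewrite -bigU //=; apply: eq_bigl => u; rewrite !inE.
Qed.

Lemma extsign0l T : extsign set0 T = 1.
Proof. by rewrite /extsign /inversions big_set0. Qed.

Lemma extsign0r T : extsign T set0 = 1.
Proof.
by rewrite /extsign /inversions big1 // => t _; rewrite big_set0.
Qed.

Lemma extsign_sqr T U : extsign T U * extsign T U = 1.
Proof. by rewrite /extsign -exprD addnn -signr_odd odd_double. Qed.

Lemma setUDK T W S : T \subset S -> W \subset S :\: T ->
  (T :|: W) :\: T = W.
Proof.
move=> sTS sW; apply/setP=> i; rewrite !inE.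
by have := subsetP sW i; rewrite !inE; case: (i \in W) => // [/(_ isT)/andP[-> _]|];
  case: (i \in T).
Qed.

Lemma extmulA : associative extmul.
Proof.
move=> a b c; apply/ffunP=> S; rewrite !ffunE.
under eq_bigr => T _ do rewrite ffunE mulr_sumr.
under [RHS]eq_bigr => V _ do rewrite ffunE mulr_sumr mulr_suml.
rewrite [RHS](exchange_big_dep (fun T : {set 'I_n} => T \subset S)) /=; last first.
  by move=> V T sVS sTV; apply: subset_trans sTV sVS.
apply: eq_bigr => T sTS.
rewrite [RHS](reindex_onto (fun W => T :|: W) (fun V => V :\: T)) /=; last first.
  by move=> V /andP[_ sTV]; rewrite setDE setUIr setUCr setIT; apply/setUidPr.
apply: eq_big => [W|W sW].
  rewrite subUset sTS subsetUl andbT /=; apply/idP/andP => [sW|[sW /eqP<-]].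
    split; last by apply/eqP/(setUDK sTS).
    by apply: subset_trans sW _; apply: subsetDl.
  by apply: setSD; rewrite subUset sTS.
have dTW : [disjoint T & W].
  by rewrite disjoint_sym disjoints_subset (subset_trans sW) // setDE subsetIr.
rewrite (setUDK sTS sW) setDDl extsignUl //.
have {1}-> : S :\: T = W :|: (S :\: (T :|: W)).
  apply/setP=> i; have := subsetP sW i; rewrite !inE.
  by case: (i \in W) => // [/(_ isT)/andP[-> ->]|]; case: (i \in T).
rewrite extsignUr; last first.
  by rewrite disjoint_sym disjoints_subset; apply/subsetP=> i; rewrite !inE;
    case: (i \in W); rewrite ?orbT.
ring.
Qed.

Lemma ext1mul : left_id (extbasis set0) extmul.
Proof.
move=> a; apply/ffunP=> S; rewrite ffunE (bigD1 set0) ?sub0set //= ffunE eqxx.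
rewrite extsign0l setD0 !mul1r big1 ?addr0 // => T /andP[_ /negPf nT0].
by rewrite ffunE nT0 mulr0 mul0r.
Qed.

Lemma extmul1 : right_id (extbasis set0) extmul.
Proof.
move=> a; apply/ffunP=> S; rewrite ffunE (bigD1 S) //= ffunE setDv eqxx.
rewrite extsign0r mulr1 mul1r big1 ?addr0 // => T /andP[sTS nTS].
rewrite ffunE setD_eq0; case: (boolP (S \subset T)) => [sST|]; last by rewrite mulr0.
by case/negP: nTS; rewrite eqEsubset sTS.
Qed.

Lemma extmulDl : left_distributive extmul +%R.
Proof.
move=> a b c; apply/ffunP=> S; rewrite !ffunE -big_split /=.
by apply: eq_bigr => T _; rewrite ffunE mulrDr mulrDl.
Qed.

Lemma extmulDr : right_distributive extmul +%R.
Proof.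
move=> a b c; apply/ffunP=> S; rewrite !ffunE -big_split /=.
by apply: eq_bigr => T _; rewrite ffunE mulrDr.
Qed.

Lemma extbasis_neq0 T : extbasis T != 0.
Proof.
by apply/eqP=> /ffunP/(_ T); rewrite !ffunE eqxx; apply/eqP/oner_neq0.
Qed.

End ExteriorTheory.

HB.instance Definition _ R n := GRing.Zmodule_isNzRing.Build (exterior R n)
  (@extmulA R n) (@ext1mul R n) (@extmul1 R n) (@extmulDl R n) (@extmulDr R n)
  (extbasis_neq0 R set0).

Section ExteriorAlgebra.
Variables (R : comNzRingType) (n : nat).
Implicit Types (a b c : exterior R n) (S T U V W : {set 'I_n}) (i j : 'I_n).

Lemma extZE (r : R) a S : (r *: a) S = r * a S.
Proof. by rewrite ffunE. Qed.

Lemma extDE a b S : (a + b) S = a S + b S.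
Proof. by rewrite ffunE. Qed.

Lemma extME a b S : (a * b) S =
  \sum_(T : {set 'I_n} | T \subset S) extsign R T (S :\: T) * a T * b (S :\: T).
Proof. by rewrite ffunE. Qed.

Lemma extscaleAl (r : R) a b : r *: (a * b) = (r *: a) * b.
Proof.
apply/ffunP=> S; rewrite extZE !extME mulr_sumr.
by apply: eq_bigr => T _; rewrite extZE; ring.
Qed.

Lemma extscaleAr (r : R) a b : r *: (a * b) = a * (r *: b).
Proof.
apply/ffunP=> S; rewrite extZE !extME mulr_sumr.
by apply: eq_bigr => T _; rewrite extZE; ring.
Qed.

HB.instance Definition _ :=
  GRing.Lmodule_isLalgebra.Build R (exterior R n) extscaleAl.
HB.instance Definition _ :=
  GRing.Lalgebra_isAlgebra.Build R (exterior R n) extscaleAr.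

Lemma extbasisE a : a = \sum_S a S *: extbasis R S.
Proof.
apply/ffunP=> S; rewrite sum_ffunE (bigD1 S) //= extZE ffunE eqxx mulr1.
rewrite big1 ?addr0 // => T /negPf nTS.
by rewrite extZE ffunE eq_sym nTS mulr0.
Qed.

Lemma extbasisM T U : [disjoint T & U] ->
  extbasis R T * extbasis R U = extsign R T U *: extbasis R (T :|: U).
Proof.
move=> dTU; have UE : (T :|: U) :\: T = U.
  by rewrite setDUl setDv set0U; apply/setDidPl; rewrite disjoint_sym.
apply/ffunP=> S; rewrite extZE extME ffunE; case: (eqVneq S (T :|: U)) => [->|nS].
  rewrite mulr1 (bigD1 T) ?subsetUl //= UE !ffunE !eqxx !mulr1 big1 ?addr0 //.
  by move=> V /andP[_ /negPf nVT]; rewrite ffunE nVT mulr0 mul0r.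
rewrite mulr0 big1 // => V sVS; rewrite !ffunE.
case: eqVneq => [VT|_]; last by rewrite mulr0 mul0r.
case: eqVneq => [VU|_]; last by rewrite mulr0.
by case/eqP: nS; rewrite -VU VT -VT setDE setUIr setUCr setIT; apply/esym/setUidPr.
Qed.

Lemma extbasisM0 T U : ~~ [disjoint T & U] ->
  extbasis R T * extbasis R U = 0.
Proof.
move=> ndTU; apply/ffunP=> S; rewrite extME ffunE big1 // => V sVS; rewrite !ffunE.
case: eqVneq => [VT|_]; last by rewrite mulr0 mul0r.
case: eqVneq => [VU|_]; last by rewrite mulr0.
by case/negP: ndTU; rewrite -VT -VU disjoint_sym disjoints_subset setDE subsetIr.
Qed.

Lemma extgen_sqr i : extgen R i * extgen R i = 0.
Proof. by apply: extbasisM0; rewrite -setI_eq0 setIid -cards_eq0 cards1. Qed.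

Lemma extsign_swap i T : i \notin T ->
  extsign R T [set i] * extsign R [set i] T = (-1) ^+ #|T|.
Proof.
move=> niT; rewrite /extsign -exprD; congr (_ ^+ _).
rewrite /inversions big_set1 -big_split -sum1_card; apply: eq_bigr => t tT /=.
rewrite big_set1; have : t != i by apply: contraNneq niT => <-.
by rewrite -val_eqE /=; case: ltngtP.
Qed.

Lemma extsign_swap1 i j : i != j ->
  extsign R [set i] [set j] = - extsign R [set j] [set i].
Proof.
move=> nij; have := @extsign_swap j [set i]; rewrite inE eq_sym => /(_ nij).
rewrite cards1 expr1 => E.
by rewrite -[LHS]mulr1 -(extsign_sqr R [set j] [set i]) mulrA E mulN1r.
Qed.

Lemma extgen_anti i j : extgen R i * extgen R j = - (extgen R j * extgen R i).
Proof.
case: (eqVneq i j) => [->|nij]; first by rewrite extgen_sqr oppr0.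
rewrite !extbasisM ?disjoints1 ?inE // 1?eq_sym //.
by rewrite (extsign_swap1 nij) scaleNr setUC.
Qed.

Definition extproj (p : nat) a : exterior R n :=
  [ffun S : {set 'I_n} => if #|S| == p then a S else 0].

Definition contract i a : exterior R n :=
  [ffun S : {set 'I_n} =>
    if i \in S then 0 else extsign R [set i] S * a (i |: S)].

Lemma extproj_linear p : linear (extproj p).
Proof.
move=> r a b; apply/ffunP=> S; rewrite !ffunE.
by case: ifP => // _; rewrite scaler0 addr0.
Qed.

Lemma extprojK p q a :
  extproj p (extproj q a) = if p == q then extproj q a else 0.
Proof.
apply/ffunP=> S; rewrite !ffunE; case: (eqVneq #|S| p) => [<-|nSp].
  by case: eqP => [<-|_]; rewrite !ffunE ?eqxx.
by case: eqP => [<-|_]; rewrite !ffunE // (negPf nSp).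
Qed.

Lemma extproj_sum a : a = \sum_(p < n.+1) extproj p a.
Proof.
apply/ffunP=> S; rewrite sum_ffunE.
have cS : (#|S| < n.+1)%N by rewrite ltnS -[leqRHS]card_ord max_card.
rewrite (bigD1 (Ordinal cS)) //= ffunE eqxx big1 ?addr0 // => p.
by rewrite -val_eqE ffunE /= eq_sym => /negPf->.
Qed.

Lemma extproj_id p a :
  extproj p a = a <-> forall S, #|S| != p -> a S = 0.
Proof.
split=> [<- S /negPf cS|H]; first by rewrite ffunE cS.
by apply/ffunP=> S; rewrite ffunE; case: eqVneq => // /H.
Qed.

Lemma extproj1 : extproj 0 1 = 1.
Proof.
by apply/extproj_id=> S; rewrite cards_eq0 ffunE => /negPf->.
Qed.

Lemma extprojM p q a b : extproj p a = a -> extproj q b = b ->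
  extproj (p + q) (a * b) = a * b.
Proof.
move=> /extproj_id pa /extproj_id qb; apply/extproj_id=> S cS.
rewrite extME big1 // => T sTS; case: (eqVneq #|T| p) => [cT|/pa->].
  rewrite qb ?mulr0 //; apply: contraNneq cS => <-.
  by rewrite -cT -(cardsID T S) (setIidPr sTS).
by rewrite mulr0 mul0r.
Qed.

Lemma contract_linear i : linear (contract i).
Proof.
move=> r a b; apply/ffunP=> S; rewrite !ffunE.
case: ifP => _; first by rewrite scaler0 addr0.
by rewrite /GRing.scale /=; ring.
Qed.

Lemma extproj_contract p i a : extproj p.+1 a = a ->
  extproj p (contract i a) = contract i a.
Proof.
move=> /extproj_id pa; apply/extproj_id=> S cS; rewrite ffunE.
by case: ifPn => // niS; rewrite pa ?mulr0 // cardsU1 niS.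
Qed.

Lemma contract0 i a : extproj 0 a = a -> contract i a = 0.
Proof.
move=> /extproj_id pa; apply/ffunP=> S; rewrite !ffunE.
by case: ifPn => // niS; rewrite pa ?mulr0 // cardsU1 niS.
Qed.

Lemma contract_anti i j a : contract i (contract j a) = - contract j (contract i a).
Proof.
apply/ffunP=> S; rewrite !ffunE !inE; case: (boolP (i \in S)) => iS.
  by rewrite orbT; case: ifP; rewrite ?mulr0 oppr0.
case: (boolP (j \in S)) => jS; first by rewrite orbT mulr0 oppr0.
rewrite !orbF [i == j]eq_sym; case: eqVneq => [_|nji]; first by rewrite !mulr0 oppr0.
rewrite !extsignUr ?disjoints1 // (extsign_swap1 nji) setUCA; ring.
Qed.

Lemma contractxx i a : contract i (contract i a) = 0.
Proof. by apply/ffunP=> S; rewrite !ffunE !inE eqxx; case: ifP; rewrite ?mulr0. Qed.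

Lemma contract_gen i j : contract i (extgen R j) = (i == j)%:R.
Proof.
apply/ffunP=> S; rewrite ffunE; case: (eqVneq S set0) => [->|nS0].
  rewrite inE extsign0r mul1r setU0 ffunE (inj_eq set1_inj).
  by case: eqP; rewrite ffunE // eqxx.
have ->: ((i == j)%:R : exterior R n) S = 0.
  by case: eqP => _; rewrite ffunE // (negPf nS0).
case: ifPn => // niS; rewrite ffunE; case: eqP; rewrite ?mulr0 //.
move=> /(congr1 (fun A : {set 'I_n} => #|A|)).
by rewrite cardsU1 niS cards1 => -[] /cards0_eq/eqP; rewrite (negPf nS0).
Qed.

Lemma signZE p a : (-1) ^+ p * a = ((-1) ^+ p : R) *: a.
Proof.
by rewrite -signr_odd -(signr_odd R); case: (odd p);
  rewrite ?expr1 ?expr0 ?mulN1r ?mul1r ?scaleN1r ?scale1r.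
Qed.

Lemma big_setU1_in i S (F : {set 'I_n} -> R) :
  \sum_(T : {set 'I_n} | (T \subset i |: S) && (i \in T)) F T =
  \sum_(T : {set 'I_n} | (T \subset S) && (i \notin T)) F (i |: T).
Proof.
rewrite (reindex_onto (fun T => i |: T) (fun T => T :\ i)) /=; last first.
  by move=> T /andP[_]; apply: setD1K.
apply: eq_bigl => T; rewrite setU11 andbT; case: (boolP (i \in T)) => iT.
  rewrite andbF andbC; case: eqP => // /setP/(_ i).
  by rewrite !inE eqxx iT.
rewrite setU1K // eqxx !andbT; apply/subsetP/subsetP => sT j jT.
  have := sT j; rewrite !inE jT orbT => /(_ isT)/predU1P[ji|//].
  by rewrite -ji jT in iT.
by move: jT; rewrite !inE => /predU1P[->|/sT->]; rewrite ?eqxx ?orbT.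
Qed.

Lemma contractM i p a b : extproj p a = a ->
  contract i (a * b) = contract i a * b + (-1) ^+ p * (a * contract i b).
Proof.
move=> /extproj_id pa; rewrite signZE; apply/ffunP=> S.
rewrite [LHS]ffunE extDE extZE !extME !mulr_sumr.
case: ifPn => iS.
  rewrite (bigID (fun T : {set 'I_n} => i \in T)) /= big1 ?add0r; last first.
    by move=> T /andP[_ iT]; rewrite ffunE iT mulr0 mul0r.
  rewrite [X in _ + X](bigID (fun T : {set 'I_n} => i \in T)) /=.
  rewrite [X in _ + (_ + X)]big1 ?addr0; last first.
    by move=> T /andP[_ niT]; rewrite ffunE !inE niT iS !mulr0.
  have SE : i |: S = S by apply/setUidPr; rewrite sub1set.
  have := big_setU1_in i S; rewrite SE => ->.
  rewrite -big_split /= big1 // => T /andP[sTS niT].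
  case: (eqVneq #|i |: T| p) => [cT|ncT]; last first.
    by rewrite !ffunE (pa _ ncT) (negPf niT) !(mulr0, mul0r) addr0.
  have EU : S :\: T = i |: (S :\: (i |: T)).
    apply/setP=> j; rewrite !inE; case: eqVneq => // ->.
    by rewrite niT iS.
  have ni : i \notin S :\: (i |: T) by rewrite !inE eqxx.
  rewrite !ffunE (negPf niT) (negPf ni) -EU {1}EU.
  rewrite extsignUr ?disjoints1 // extsignUl ?disjoints1 //.
  move: cT; rewrite cardsU1 niT => <-; rewrite exprS -(extsign_swap niT).
  have := extsign_sqr R [set i] T; have := extsign_sqr R [set i] (S :\: (i |: T)).
  move: (extsign _ _ _) (extsign _ _ _) (extsign _ _ _) (extsign _ _ _) => s1 s2 s3 s4.
  set u := a _; set v := b _ => E1 E2.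
  ring: E1 E2.
rewrite (bigID (fun T : {set 'I_n} => i \in T)) /=.
congr (_ + _).
  rewrite big_setU1_in; apply: eq_big => T.
    by rewrite andb_idr // => sTS; apply: contra iS; apply: (subsetP sTS).
  move=> /andP[sTS niT]; rewrite ffunE (negPf niT).
  have -> : (i |: S) :\: (i |: T) = S :\: T.
    apply/setP=> j; rewrite !inE; case: eqVneq => //= ->.
    by rewrite (negPf iS) andbF.
  rewrite extsignUl ?disjoints1 //.
  have -> : extsign R [set i] S = extsign R [set i] T * extsign R [set i] (S :\: T).
    rewrite -extsignUr; first by rewrite setDE setUIr setUCr setIT (setUidPr sTS).
    by rewrite disjoint_sym disjoints_subset setDE subsetIr.
  have := extsign_sqr R [set i] (S :\: T).
  move: (extsign _ _ _) (extsign _ _ _) (extsign _ _ _) => s1 s2 s3.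
  set u := a _; set v := b _ => E1.
  ring: E1.
apply: eq_big => T.
  apply/andP/idP => [[sT niT]|sTS].
    apply/subsetP=> j jT; have := subsetP sT j jT; rewrite !inE.
    by case/predU1P=> // ji; rewrite -ji jT in niT.
  split; last by apply: contra iS; apply: (subsetP sTS).
  by apply: subset_trans sTS _; apply: subsetUr.
move=> /andP[sT niT].
have sTS : T \subset S.
  apply/subsetP=> j jT; have := subsetP sT j jT; rewrite !inE.
  by case/predU1P=> // ji; rewrite -ji jT in niT.
case: (eqVneq #|T| p) => [cT|ncT]; last by rewrite (pa _ ncT) !(mulr0, mul0r).
have niD : i \notin S :\: T by rewrite !inE (negPf iS) andbF.
rewrite ffunE (negPf niD).
have -> : (i |: S) :\: T = i |: (S :\: T).
  by apply/setP=> j; rewrite !inE; case: eqVneq => //= ->; rewrite niT.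
rewrite extsignUr ?disjoints1 //.
have -> : extsign R [set i] S = extsign R [set i] T * extsign R [set i] (S :\: T).
  rewrite -extsignUr; first by rewrite setDE setUIr setUCr setIT (setUidPr sTS).
  by rewrite disjoint_sym disjoints_subset setDE subsetIr.
rewrite -cT -(extsign_swap niT); ring.
Qed.

End ExteriorAlgebra.

(* A dg R-algebra, graded by nat, with differential of degree -1:              *)
(* dgproj p is the projection onto the homogeneous component of degree p.      *)
HB.mixin Record isDGAlgebra (R : comNzRingType) A of GRing.Algebra R A := {
  dgproj : nat -> A -> A;
  dgdiff : A -> A;
  dgproj_linear : forall p, linear (dgproj p);
  dgprojK : forall p q a,
    dgproj p (dgproj q a) = if p == q then dgproj q a else 0;
  dgproj_sum : forall a, exists N, a = \sum_(p < N) dgproj p a;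
  dgproj1 : dgproj 0 1 = 1;
  dgprojM : forall p q a b, dgproj p a = a -> dgproj q b = b ->
    dgproj (p + q) (a * b) = a * b;
  dgdiff_linear : linear dgdiff;
  dgdiff_deg0 : forall a, dgproj 0 a = a -> dgdiff a = 0;
  dgdiff_degS : forall p a, dgproj p.+1 a = a -> dgproj p (dgdiff a) = dgdiff a;
  dgdiffM : forall p a b, dgproj p a = a ->
    dgdiff (a * b) = dgdiff a * b + (-1) ^+ p * (a * dgdiff b);
  dgdiffK : forall a, dgdiff (dgdiff a) = 0
}.

#[short(type="dgAlgType")]
HB.structure Definition DGAlgebra (R : comNzRingType) :=
  {A of isDGAlgebra R A & GRing.Algebra R A}.

Definition homogeneous (R : comNzRingType) (A : dgAlgType R) (p : nat) (a : A) :=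
  dgproj p a = a.

Section Koszul.
Variables (R : comNzRingType) (n : nat) (x : 'I_n -> R).
Implicit Types a b : exterior R n.

Definition koszul_diff a : exterior R n := \sum_(i < n) x i *: contract i a.

Lemma koszul_diff_linear : linear koszul_diff.
Proof.
move=> r a b; rewrite /koszul_diff scaler_sumr -big_split; apply: eq_bigr => i _.
by rewrite /= contract_linear scalerDr !scalerA mulrC.
Qed.

Lemma koszul_diff_gen i : koszul_diff (extgen R i) = (x i)%:A.
Proof.
rewrite /koszul_diff (bigD1 i) //= contract_gen eqxx big1 ?addr0 // => j /negPf nji.
by rewrite contract_gen nji scaler0.
Qed.

Lemma koszul_diff_deg0 a : extproj 0 a = a -> koszul_diff a = 0.
Proof.
by move=> a0; rewrite /koszul_diff big1 // => i _; rewrite contract0 ?scaler0.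
Qed.

Lemma koszul_diff_degS p a :
  extproj p.+1 a = a -> extproj p (koszul_diff a) = koszul_diff a.
Proof.
move=> pa; apply/extproj_id=> S cS; rewrite sum_ffunE big1 // => i _.
have /extproj_id H := extproj_contract i pa.
by rewrite extZE H ?mulr0.
Qed.

Lemma koszul_diffM p a b : extproj p a = a ->
  koszul_diff (a * b) = koszul_diff a * b + (-1) ^+ p * (a * koszul_diff b).
Proof.
move=> pa; rewrite /koszul_diff mulr_suml !mulr_sumr -big_split.
apply: eq_bigr => i _ /=; rewrite (contractM i b pa) scalerDr scalerAl.
by rewrite -!scalerAr.
Qed.

Lemma koszul_diffK a : koszul_diff (koszul_diff a) = 0.
Proof.
pose F i j := (x i * x j) *: contract i (contract j a).
have -> : koszul_diff (koszul_diff a) = \sum_i \sum_j F i j.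
  rewrite {1}/koszul_diff; apply: eq_bigr => i _; rewrite /koszul_diff.
  pose ci := GRing.isLinear.Build R (exterior R n) (exterior R n) *:%R
    (contract i) (contract_linear i).
  pose c : {linear exterior R n -> exterior R n} := HB.pack (contract i) ci.
  rewrite -[contract i]/(c : _ -> _) linear_sum scaler_sumr.
  by apply: eq_bigr => j _; rewrite linearZ /= scalerA.
have Fij i j : F i j = - F j i by rewrite /F contract_anti scalerN mulrC.
have -> : \sum_i \sum_j F i j = \sum_(i < n) (\sum_(j < n | (i < j)%N) F i j) +
                         \sum_(i < n) (\sum_(j < n | (j < i)%N) F i j).
  rewrite -big_split; apply: eq_bigr => i _ /=.
  rewrite (bigID (fun j : 'I_n => i < j)%N) /=; congr (_ + _).
  rewrite (bigD1 i) ?ltnn //= /F contractxx scaler0 add0r.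
  by apply: eq_bigl => j; rewrite -val_eqE -leqNgt ltn_neqAle andbC.
rewrite [X in _ + X](exchange_big_dep xpredT) //= -big_split big1 // => i _ /=.
by rewrite -big_split big1 // => j _ /=; rewrite [F j i]Fij subrr.
Qed.

Lemma koszul_diff_unique (D : exterior R n -> exterior R n) :
    linear D ->
    (forall p a b, extproj p a = a ->
      D (a * b) = D a * b + (-1) ^+ p * (a * D b)) ->
    (forall i, D (extgen R i) = (x i)%:A) ->
  D =1 koszul_diff.
Proof.
move=> Dl DM Dg.
pose DL := GRing.isLinear.Build R (exterior R n) (exterior R n) *:%R D Dl.
pose D' : {linear exterior R n -> exterior R n} := HB.pack D DL.
pose kL := GRing.isLinear.Build R (exterior R n) (exterior R n) *:%R
  koszul_diff koszul_diff_linear.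
pose k' : {linear exterior R n -> exterior R n} := HB.pack koszul_diff kL.
have D1 : D 1 = 0.
  have := DM 0 1 1 (extproj1 R n); rewrite expr0 !mul1r mulr1.
  by rewrite -{1}[D 1]addr0 => /addrI.
suff DS S : D (extbasis R S) = koszul_diff (extbasis R S).
  move=> a; rewrite [a]extbasisE -[D]/(D' : _ -> _) -[koszul_diff]/(k' : _ -> _).
  by rewrite !linear_sum; apply: eq_bigr => S _; rewrite !linearZ /= DS.
have [m] := ubnP #|S|; elim: m S => // m IHm S.
case: (set_0Vmem S) => [->|[i iS]] cS.
  by rewrite [LHS]D1 (koszul_diff_deg0 (extproj1 R n)).
have di : [disjoint [set i] & S :\ i] by rewrite disjoints1 !inE eqxx.
have := extbasisM R di; rewrite setD1K // => E.
have gi : extproj 1 (extgen R i) = extgen R i.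
  by apply/extproj_id=> T; rewrite ffunE; case: (eqVneq T [set i]) => [->|]; rewrite ?cards1.
have {E} -> : extbasis R S =
    extsign R [set i] (S :\ i) *: (extgen R i * extbasis R (S :\ i)).
  by rewrite E scalerA extsign_sqr scale1r.
rewrite -[D]/(D' : _ -> _) -[koszul_diff]/(k' : _ -> _) !linearZ /=; congr (_ *: _).
rewrite (DM 1%N _ _ gi) (koszul_diffM _ gi) Dg koszul_diff_gen IHm //.
by move: cS; rewrite (cardsD1 i) iS.
Qed.

Definition koszul of 'I_n -> R : Type := exterior R n.

HB.instance Definition _ := GRing.Algebra.copy (koszul x) (exterior R n).
HB.instance Definition _ := @isDGAlgebra.Build R (koszul x)
  (@extproj R n) koszul_diff
  (@extproj_linear R n) (@extprojK R n)
  (fun a => ex_intro _ n.+1 (extproj_sum a))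
  (@extproj1 R n) (@extprojM R n)
  koszul_diff_linear koszul_diff_deg0 koszul_diff_degS koszul_diffM koszul_diffK.

End Koszul.

Section DGTheory.
Variables (R : comNzRingType) (A : dgAlgType R).
Implicit Types a b : A.

HB.instance Definition _ :=
  GRing.isLinear.Build R A A *:%R (@dgdiff R A) (@dgdiff_linear R A).
HB.instance Definition _ p :=
  GRing.isLinear.Build R A A *:%R (@dgproj R A p) (@dgproj_linear R A p).

Lemma homogeneous_proj p a : homogeneous p (dgproj p a).
Proof. by rewrite /homogeneous dgprojK eqxx. Qed.

Lemma dgdiff_projS p a : dgdiff (dgproj p.+1 a) = dgproj p (dgdiff a).
Proof.
have [N aE] := dgproj_sum a.
rewrite {2}aE !linear_sum /=.
have dp q : dgproj p (dgdiff (dgproj q a)) =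
    if q == p.+1 then dgdiff (dgproj q a) else 0.
  case: q => [|q]; first by rewrite (dgdiff_deg0 _ (homogeneous_proj 0 a)) linear0.
  rewrite -{1}(dgdiff_degS _ _ (homogeneous_proj q.+1 a)) dgprojK eqSS eq_sym.
  by case: eqP => // ->; rewrite dgdiff_degS //; apply: homogeneous_proj.
under eq_bigr do rewrite dp.
rewrite {1}aE linear_sum linear_sum /=; apply: eq_bigr => q _.
rewrite dgprojK eq_sym; case: eqP => [->//|_]; exact: linear0.
Qed.

Lemma dgdiff_proj_cycle p a : dgdiff a = 0 -> dgdiff (dgproj p a) = 0.
Proof.
move=> da; case: p => [|p]; first exact: dgdiff_deg0 _ (homogeneous_proj 0 a).
by rewrite dgdiff_projS da linear0.
Qed.

Lemma dgdiff_Mr a b : dgdiff b = 0 -> dgdiff (a * b) = dgdiff a * b.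
Proof.
move=> db; have [N aE] := dgproj_sum a.
rewrite aE mulr_suml !linear_sum mulr_suml; apply: eq_bigr => p _ /=.
by rewrite (dgdiffM _ _ _ (homogeneous_proj p a)) db !mulr0 addr0.
Qed.

Lemma dgdiff1 : dgdiff (1 : A) = 0.
Proof. exact: dgdiff_deg0 _ (@dgproj1 R A). Qed.

Lemma cycleM_boundary a b : dgdiff a = 0 -> exists c : A, a * dgdiff b = dgdiff c.
Proof.
move=> da; have [N aE] := dgproj_sum a.
exists (\sum_(p < N) (-1) ^+ p * (dgproj p a * b)).
rewrite {1}aE mulr_suml linear_sum; apply: eq_bigr => p _ /=.
have -> (u : A) : dgdiff ((-1) ^+ p * u) = (-1) ^+ p * dgdiff u.
  by rewrite -signr_odd; case: (odd p); rewrite ?expr1 ?expr0 ?mulN1r ?mul1r ?linearN.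
rewrite (dgdiffM _ _ _ (homogeneous_proj p a)) dgdiff_proj_cycle // mul0r add0r.
by rewrite signrMK.
Qed.

Definition cycle_pred : {pred A} := [pred a | dgdiff a == 0].

Lemma cycle_subalg_closed : subalg_closed cycle_pred.
Proof.
split=> [|r a b|a b]; rewrite !inE ?dgdiff1 //.
  by move=> /eqP da /eqP db; rewrite linearP /= da db scaler0 addr0.
by move=> /eqP da /eqP db; rewrite dgdiff_Mr // da mul0r.
Qed.

HB.instance Definition _ :=
  GRing.isSubalgClosed.Build R A cycle_pred cycle_subalg_closed.

Record cycles : Type := Cycle { cycle_val : A; cycleP : cycle_val \in cycle_pred }.

HB.instance Definition _ := [isSub for cycle_val].
HB.instance Definition _ := [Choice of cycles by <:].
HB.instance Definition _ := [SubChoice_isSubAlgebra of cycles by <:].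

Lemma cycle_valM (z w : cycles) : cycle_val (z * w) = cycle_val z * cycle_val w.
Proof. exact: (rmorphM (val : cycles -> A)). Qed.

Lemma cycle_valD (z w : cycles) : cycle_val (z + w) = cycle_val z + cycle_val w.
Proof. exact: (raddfD (val : cycles -> A)). Qed.

Lemma cycle_valB (z w : cycles) : cycle_val (z - w) = cycle_val z - cycle_val w.
Proof. exact: (raddfB (val : cycles -> A)). Qed.

Lemma cycle_valZ (r : R) (z : cycles) : cycle_val (r *: z) = r *: cycle_val z.
Proof. by []. Qed.

Lemma cycle_val1 : cycle_val 1 = 1.
Proof. exact: (rmorph1 (val : cycles -> A)). Qed.

Lemma dgdiff_cycle (z : cycles) : dgdiff (cycle_val z) = 0.
Proof. by apply/eqP; case: z. Qed.

Definition boundary : {pred cycles} :=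
  [pred z | `[< exists b : A, cycle_val z = dgdiff b >]].

Lemma boundaryP (z : cycles) :
  reflect (exists b : A, cycle_val z = dgdiff b) (z \in boundary).
Proof. exact: asboolP. Qed.

Lemma boundary_zmod_closed : zmod_closed boundary.
Proof.
split=> [|z w /boundaryP[a za] /boundaryP[b wb]]; apply/boundaryP.
  by exists 0; rewrite linear0.
by exists (a - b); rewrite cycle_valB linearB /= -za -wb.
Qed.

HB.instance Definition _ :=
  GRing.isZmodClosed.Build cycles boundary boundary_zmod_closed.

Lemma boundaryMl (z w : cycles) : w \in boundary -> z * w \in boundary.
Proof.
move=> /boundaryP[b wb]; apply/boundaryP.
have [c zb] := cycleM_boundary b (dgdiff_cycle z).
by exists c; rewrite cycle_valM wb.
Qed.

Lemma boundaryMr (z w : cycles) : w \in boundary -> w * z \in boundary.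
Proof.
move=> /boundaryP[b wb]; apply/boundaryP.
by exists (b * cycle_val z); rewrite dgdiff_Mr ?dgdiff_cycle // cycle_valM wb.
Qed.

Definition homology : Type := Quotient.quot boundary.

HB.instance Definition _ := GRing.Zmodule.on homology.
HB.instance Definition _ := EqQuotient.on homology.

Definition hclass (z : cycles) : homology := \pi_homology z.

Lemma hclassP (z w : cycles) : hclass z = hclass w <-> z - w \in boundary.
Proof. by rewrite [_ \in _]Quotient.idealrBE; split=> /eqP. Qed.

Lemma hclassK : cancel (fun h : homology => repr h) hclass.
Proof. exact: reprK. Qed.

Lemma hclassD : {morph hclass : z w / z + w}.
Proof. by move=> z w; rewrite /hclass !piE. Qed.

Definition hmul (h k : homology) : homology := hclass (repr h * repr k).

Lemma hclass_mul (z w : cycles) : hmul (hclass z) (hclass w) = hclass (z * w).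
Proof.
apply/hclassP; set z' := repr _; set w' := repr _.
have -> : z' * w' - z * w = (z' - z) * w' + z * (w' - w).
  by rewrite mulrBl mulrBr addrA subrK.
by apply: rpredD; [apply: boundaryMr | apply: boundaryMl]; apply/hclassP;
  rewrite hclassK.
Qed.

Lemma hmulA : associative hmul.
Proof.
by move=> a b c; rewrite -[a]hclassK -[b]hclassK -[c]hclassK !hclass_mul mulrA.
Qed.

Lemma hmul1 : left_id (hclass 1) hmul.
Proof. by move=> a; rewrite -[a]hclassK hclass_mul mul1r. Qed.

Lemma hmulr1 : right_id (hclass 1) hmul.
Proof. by move=> a; rewrite -[a]hclassK hclass_mul mulr1. Qed.

Lemma hmulDl : left_distributive hmul +%R.
Proof.
move=> a b c; rewrite -[a]hclassK -[b]hclassK -[c]hclassK.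
by rewrite -hclassD !hclass_mul mulrDl hclassD.
Qed.

Lemma hmulDr : right_distributive hmul +%R.
Proof.
move=> a b c; rewrite -[a]hclassK -[b]hclassK -[c]hclassK.
by rewrite -hclassD !hclass_mul mulrDr hclassD.
Qed.

HB.instance Definition _ := GRing.Zmodule_isPzRing.Build homology
  hmulA hmul1 hmulr1 hmulDl hmulDr.

Lemma hclassM : {morph hclass : z w / z * w}.
Proof. by move=> z w; rewrite -hclass_mul. Qed.

Lemma hclass1 : hclass 1 = 1. Proof. by []. Qed.

Record dgAut : Type := DGAut {
  dgaut_fun :> {lrmorphism A -> A};
  dgaut_bij : bijective dgaut_fun;
  dgaut_deg : forall p a, homogeneous p a -> homogeneous p (dgaut_fun a);
  dgaut_diff : forall a, dgaut_fun (dgdiff a) = dgdiff (dgaut_fun a)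
}.

Lemma dgaut_cycle (phi : dgAut) (z : cycles) : phi (cycle_val z) \in cycle_pred.
Proof. by rewrite inE -dgaut_diff dgdiff_cycle rmorph0. Qed.

Definition cycle_map (phi : dgAut) (z : cycles) : cycles :=
  Cycle (dgaut_cycle phi z).

Definition hmap (phi : dgAut) (h : homology) : homology :=
  hclass (cycle_map phi (repr h)).

Lemma hmapE (phi : dgAut) (z : cycles) : hmap phi (hclass z) = hclass (cycle_map phi z).
Proof.
apply/hclassP/boundaryP.
have /hclassP/boundaryP[b zb] : hclass (repr (hclass z)) = hclass z by rewrite hclassK.
exists (phi b); rewrite cycle_valB /= -rmorphB /= -dgaut_diff -zb.
by rewrite cycle_valB.
Qed.

End DGTheory.

Arguments cycle_pred {R} A.
Arguments boundary {R} A.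

Lemma dgaut_id_subproof (R : comNzRingType) (A : dgAlgType R) : bijective (@idfun A).
Proof. by exists id. Qed.

Section DGAut.
Variables (R : comNzRingType) (A : dgAlgType R).
Implicit Types phi psi : dgAut A.

Definition dgaut1 : dgAut A :=
  @DGAut R A (idfun : {lrmorphism A -> A}) (dgaut_id_subproof A)
    (fun p a h => h) (fun a => erefl).

Lemma dgaut_comp_deg phi psi p a : homogeneous p a -> homogeneous p ((phi \o psi) a).
Proof. by move=> pa; do 2 apply: dgaut_deg. Qed.

Lemma dgaut_comp_diff phi psi a : (phi \o psi) (dgdiff a) = dgdiff ((phi \o psi) a).
Proof. by rewrite /= !dgaut_diff. Qed.

Definition dgaut_comp phi psi : dgAut A :=
  @DGAut R A (phi \o psi : {lrmorphism A -> A})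
    (bij_comp (dgaut_bij phi) (dgaut_bij psi))
    (dgaut_comp_deg phi psi) (dgaut_comp_diff phi psi).

Lemma dgaut_proj phi p a : phi (dgproj p a) = dgproj p (phi a).
Proof.
have [N aE] := dgproj_sum a.
rewrite [in RHS]aE !linear_sum /= [in LHS]aE !linear_sum /=.
apply: eq_bigr => q _.
rewrite -[in RHS](dgaut_deg phi (homogeneous_proj q a)) !dgprojK.
case: eqP => _; last exact: linear0.
by rewrite (dgaut_deg phi (homogeneous_proj q a)).
Qed.

Lemma dgaut_inv_exists phi :
  {psi : dgAut A | cancel phi psi & cancel psi phi}.
Proof.
apply/cid2; case: (dgaut_bij phi) => g fK gK.
have gl : linear g by apply: can2_linear fK gK.
have gm : monoid_morphism g.
  by split=> [|a b]; apply: (can_inj fK); rewrite gK ?rmorph1 // rmorphM /= !gK.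
pose gL := GRing.isLinear.Build R A A *:%R g gl.
pose gM := GRing.isMonoidMorphism.Build A A g gm.
pose G : {lrmorphism A -> A} := HB.pack g gL gM.
have Gb : bijective G by exists (phi : A -> A).
have Gd p a : homogeneous p a -> homogeneous p (G a).
  by move=> pa; apply: (can_inj fK); rewrite dgaut_proj !gK.
have Gf a : G (dgdiff a) = dgdiff (G a).
  by apply: (can_inj fK); rewrite dgaut_diff !gK.
by exists (DGAut Gb Gd Gf).
Qed.

Definition dgaut_inv phi : dgAut A := s2val (dgaut_inv_exists phi).

Lemma dgautK phi : cancel phi (dgaut_inv phi).
Proof. exact: s2valP (dgaut_inv_exists phi). Qed.

Lemma dgautVK phi : cancel (dgaut_inv phi) phi.
Proof. exact: s2valP' (dgaut_inv_exists phi). Qed.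

Lemma hmap1 h : hmap dgaut1 h = h.
Proof.
by rewrite -[h]hclassK hmapE; congr (hclass _); apply: val_inj.
Qed.

Lemma hmap_comp phi psi h : hmap (dgaut_comp phi psi) h = hmap phi (hmap psi h).
Proof.
by rewrite -[h]hclassK !hmapE; congr (hclass _); apply: val_inj.
Qed.

Lemma hmapK phi : cancel (hmap phi) (hmap (dgaut_inv phi)).
Proof.
move=> h; rewrite -[h]hclassK !hmapE; congr (hclass _).
by apply: val_inj; rewrite /= dgautK.
Qed.

Lemma hmapVK phi : cancel (hmap (dgaut_inv phi)) (hmap phi).
Proof.
move=> h; rewrite -[h]hclassK !hmapE; congr (hclass _).
by apply: val_inj; rewrite /= dgautVK.
Qed.

Lemma hmapD phi : {morph hmap phi : h k / h + k}.
Proof.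
move=> h k; rewrite -[h]hclassK -[k]hclassK -hclassD !hmapE -hclassD.
by congr (hclass _); apply: val_inj; rewrite /= raddfD.
Qed.

Lemma hmapM phi : {morph hmap phi : h k / h * k}.
Proof.
move=> h k; rewrite -[h]hclassK -[k]hclassK -hclassM !hmapE -hclassM.
by congr (hclass _); apply: val_inj; rewrite /= rmorphM.
Qed.

Lemma hmap_1 phi : hmap phi 1 = 1.
Proof.
rewrite -hclass1 hmapE; congr (hclass _); apply: val_inj.
by rewrite /= rmorph1.
Qed.

End DGAut.

Definition is_ideal (R : comNzRingType) (I : R -> Prop) : Prop :=
  [/\ I 0, forall a b, I a -> I b -> I (a + b) & forall r a, I a -> I (r * a)].

Definition in_span (R : comNzRingType) (n : nat) (g : 'I_n -> R)
    (J : {set 'I_n}) (a : R) : Prop :=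
  exists c : 'I_n -> R, a = \sum_(i in J) c i * g i.

HB.mixin Record isNoetherian R of GRing.ComNzRing R := {
  ideal_fingen : forall I : R -> Prop, is_ideal I ->
    exists n (g : 'I_n -> R), forall a, I a <-> in_span g setT a
}.

HB.mixin Record isLocalRing R of GRing.ComUnitRing R := {
  nonunitD : forall a b : R, a \isn't a GRing.unit -> b \isn't a GRing.unit ->
    a + b \isn't a GRing.unit
}.

#[short(type="localRingType")]
HB.structure Definition LocalRing := {R of GRing.ComUnitRing R & isLocalRing R}.

#[short(type="noethLocalRingType")]
HB.structure Definition NoethLocalRing := {R of LocalRing R & isNoetherian R}.

Section LocalRingTheory.
Variable R : localRingType.

Definition max_ideal : {pred R} := [pred a | a \isn't a GRing.unit].

Lemma max_ideal_closed : idealr_closed max_ideal.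
Proof.
split; rewrite ?inE ?unitr0 ?unitr1 // => r a b; rewrite !inE => ua ub.
by apply: nonunitD => //; rewrite unitrM negb_and ua orbT.
Qed.

Lemma max_ideal_prime : prime_idealr_closed max_ideal.
Proof. by move=> a b; rewrite !inE unitrM negb_and. Qed.

HB.instance Definition _ := isIdealr.Build R max_ideal max_ideal_closed.
HB.instance Definition _ := isPrimeIdealrClosed.Build R max_ideal max_ideal_prime.

Lemma max_idealP (I : R -> Prop) :
  is_ideal I -> ~ I 1 -> forall a, I a -> a \in max_ideal.
Proof.
move=> [_ _ IM] I1 a Ia; rewrite inE; apply/negP=> ua; apply: I1.
by rewrite -(mulVr ua); apply: IM.
Qed.

Definition residue_field : Type := {ideal_quot max_ideal}.

HB.instance Definition _ := GRing.ComNzRing.on residue_field.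
HB.instance Definition _ := EqQuotient.on residue_field.

Definition residue (a : R) : residue_field := \pi_residue_field a.

Lemma residueK : cancel (fun u : residue_field => repr u) residue.
Proof. exact: reprK. Qed.

Lemma residueP (a b : R) : residue a = residue b <-> a - b \in max_ideal.
Proof. by rewrite [_ \in _]Quotient.idealrBE; split=> /eqP. Qed.

Lemma residueM : {morph residue : a b / a * b}.
Proof. by move=> a b; rewrite /residue !piE. Qed.

Lemma residueD : {morph residue : a b / a + b}.
Proof. by move=> a b; rewrite /residue !piE. Qed.

Lemma residue1 : residue 1 = 1.
Proof. by rewrite /residue !piE. Qed.

Lemma residue0 : residue 0 = 0.
Proof. by rewrite /residue !piE. Qed.

Definition residue_inv (u : residue_field) : residue_field :=
  if u == 0 then 0 else residue (repr u)^-1.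

Lemma residue_mulVf u : u != 0 -> residue_inv u * u = 1.
Proof.
move=> nu0; rewrite /residue_inv (negPf nu0) -{2}[u]residueK -residueM.
rewrite mulVr ?residue1 //; apply: contraNT nu0 => nu.
by rewrite -[u]residueK -residue0; apply/eqP/residueP; rewrite subr0.
Qed.

Lemma residue_inv0 : residue_inv 0 = 0.
Proof. by rewrite /residue_inv eqxx. Qed.

HB.instance Definition _ :=
  GRing.ComNzRing_isField.Build residue_field residue_mulVf residue_inv0.

Definition generates_max_ideal n (g : 'I_n -> R) (J : {set 'I_n}) : Prop :=
  forall a, a \in max_ideal <-> in_span g J a.

Record minGens (n : nat) : Type := MinGens {
  mingens_fun :> 'I_n -> R;
  mingens_gen : generates_max_ideal mingens_fun setT;
  mingens_min : forall J : {set 'I_n}, J \proper setT ->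
    ~ generates_max_ideal mingens_fun J
}.

End LocalRingTheory.

Arguments max_ideal R : clear implicits.

Section KoszulHomology.
Variables (R : localRingType) (n : nat) (x : minGens R n).
Implicit Types (z w : cycles (koszul x)).

Lemma max_ideal_boundary (r : R) z : r \in max_ideal R -> r *: z \in boundary (koszul x).
Proof.
move=> /(mingens_gen x)[c rE]; apply/boundaryP.
pose e : koszul x := \sum_(i < n) c i *: extgen R i.
exists (e * cycle_val z); rewrite cycle_valZ (dgdiff_Mr _ (dgdiff_cycle z)).
have -> : dgdiff e = r%:A.
  rewrite rE /e linear_sum scaler_suml; apply: eq_big => [i|i _].
    by rewrite inE.
  by rewrite linearZ /= -scalerA; congr (_ *: _); apply: koszul_diff_gen.
by rewrite mulr_algl.
Qed.

Lemma one_boundary : (1 : cycles (koszul x)) \notin boundary (koszul x).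
Proof.
apply/boundaryP=> -[b]; rewrite cycle_val1 => /ffunP/(_ set0).
rewrite ffunE eqxx sum_ffunE => E.
have : (1 : R) \in max_ideal R.
  have -> : 1 = \sum_(i in [set: 'I_n]) contract i b set0 * x i :> R.
    rewrite [LHS]E; apply: eq_big => [i|i _]; first by rewrite inE.
    by rewrite extZE mulrC.
  by apply/(mingens_gen x); exists (fun i => contract i b set0).
by rewrite idealr1.
Qed.

Definition koszulH : Type := homology (koszul x).

HB.instance Definition _ := GRing.PzRing.on koszulH.

Lemma koszulH_neq0 : (1 : koszulH) != 0.
Proof.
apply/eqP; have -> : (0 : koszulH) = hclass 0 by rewrite /hclass !piE.
by move=> /hclassP; rewrite subr0; apply/negP/one_boundary.
Qed.

HB.instance Definition _ := GRing.PzSemiRing_isNonZero.Build koszulH koszulH_neq0.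

(* residue r *: hclass z = hclass (r *: z), see koszulH_scaleE *)
Definition koszulH_scale (u : residue_field R) (h : koszulH) : koszulH :=
  hclass (repr u *: repr h).

Lemma koszulH_scaleE (r : R) z :
  koszulH_scale (residue r) (hclass z) = hclass (r *: z).
Proof.
apply/hclassP; set s := repr _; set w := repr _.
have -> : s *: w - r *: z = (s - r) *: w + r *: (w - z).
  by rewrite scalerBl scalerBr addrA subrK.
apply: rpredD; first by apply: max_ideal_boundary; apply/residueP; rewrite residueK.
rewrite -mulr_algl; apply: boundaryMl; apply/hclassP.
exact: hclassK.
Qed.

Lemma koszulH_scalerA u v h :
  koszulH_scale u (koszulH_scale v h) = koszulH_scale (u * v) h.
Proof.
rewrite -[u]residueK -[v]residueK -[h]hclassK -residueM !koszulH_scaleE.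
by rewrite scalerA.
Qed.

Lemma koszulH_scale1 : left_id 1 koszulH_scale.
Proof. by move=> h; rewrite -[h]hclassK -residue1 koszulH_scaleE scale1r. Qed.

Lemma koszulH_scalerDr : right_distributive koszulH_scale +%R.
Proof.
move=> u h k; rewrite -[u]residueK -[h]hclassK -[k]hclassK -hclassD.
by rewrite !koszulH_scaleE scalerDr hclassD.
Qed.

Lemma koszulH_scalerDl h : {morph koszulH_scale^~ h : u v / u + v}.
Proof.
move=> u v; rewrite -[u]residueK -[v]residueK -[h]hclassK -residueD.
by rewrite !koszulH_scaleE scalerDl hclassD.
Qed.

HB.instance Definition _ := GRing.Zmodule_isLmodule.Build (residue_field R) koszulH
  koszulH_scalerA koszulH_scale1 koszulH_scalerDr koszulH_scalerDl.

Lemma koszulH_scalerAl (u : residue_field R) (h k : koszulH) :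
  u *: (h * k) = (u *: h) * k.
Proof.
rewrite -[u]residueK -[h]hclassK -[k]hclassK -hclassM.
transitivity (hclass (repr u *: repr h) * hclass (repr k)).
  by rewrite [LHS]koszulH_scaleE -hclassM scalerAl.
by congr (_ * _); apply/esym/koszulH_scaleE.
Qed.

Lemma koszulH_scalerAr (u : residue_field R) (h k : koszulH) :
  u *: (h * k) = h * (u *: k).
Proof.
rewrite -[u]residueK -[h]hclassK -[k]hclassK -hclassM.
transitivity (hclass (repr h) * hclass (repr u *: repr k)).
  by rewrite [LHS]koszulH_scaleE -hclassM scalerAr.
by congr (_ * _); apply/esym/koszulH_scaleE.
Qed.

HB.instance Definition _ :=
  GRing.Lmodule_isLalgebra.Build (residue_field R) koszulH koszulH_scalerAl.
HB.instance Definition _ :=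
  GRing.Lalgebra_isAlgebra.Build (residue_field R) koszulH koszulH_scalerAr.

End KoszulHomology.

Section AlgebraAutomorphisms.
Variables (k : comNzRingType) (H : algType k).

Definition is_algaut (f : H -> H) : Prop :=
  [/\ linear f, monoid_morphism f & bijective f].

Record algAut : Type := AlgAut { algaut_fun :> H -> H; _ : `[< is_algaut algaut_fun >] }.

HB.instance Definition _ := [isSub for algaut_fun].
HB.instance Definition _ := [Choice of algAut by <:].

Lemma algautP (f : algAut) : is_algaut f.
Proof. by case: f => f fP; apply/asboolP. Qed.

Lemma algaut_eq (f g : algAut) : f =1 g -> f = g.
Proof. by move=> fg; apply/val_inj/funext. Qed.

Lemma is_algaut1 : is_algaut id.
Proof. by split=> //; exists id. Qed.

Lemma is_algaut_comp (f g : H -> H) : is_algaut f -> is_algaut g -> is_algaut (f \o g).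
Proof.
move=> [fl [f1 fM] fb] [gl [g1 gM] gb]; split; last exact: bij_comp.
  by move=> r a b; rewrite /= gl fl.
by split=> [|a b] /=; rewrite ?g1 ?gM.
Qed.

Lemma is_algaut_inv (f : algAut) : {g : H -> H | is_algaut g & cancel f g /\ cancel g f}.
Proof.
apply: cid2; case: (algautP f) => fl [f1 fM] [g fK gK]; exists g => //.
split; last by exists f.
  by move=> r a b; apply: (can_inj fK); rewrite fl !gK.
by split=> [|a b]; apply: (can_inj fK); rewrite gK ?f1 // fM !gK.
Qed.

Definition algaut1 : algAut := AlgAut (introT (asboolP _) is_algaut1).

Definition algaut_mul (f g : algAut) : algAut :=
  AlgAut (introT (asboolP _) (is_algaut_comp (algautP f) (algautP g))).

Definition algaut_inv (f : algAut) : algAut :=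
  AlgAut (introT (asboolP _) (s2valP (is_algaut_inv f))).

Lemma algaut_mulA : associative algaut_mul.
Proof. by move=> f g h; apply: algaut_eq. Qed.

Lemma algaut_mul1 : left_id algaut1 algaut_mul.
Proof. by move=> f; apply: algaut_eq. Qed.

Lemma algaut_mulr1 : right_id algaut1 algaut_mul.
Proof. by move=> f; apply: algaut_eq. Qed.

Lemma algaut_mulV : left_inverse algaut1 algaut_inv algaut_mul.
Proof. by move=> f; apply: algaut_eq => h /=; case: (s2valP' (is_algaut_inv f)). Qed.

Lemma algaut_mulrV : right_inverse algaut1 algaut_inv algaut_mul.
Proof. by move=> f; apply: algaut_eq => h /=; case: (s2valP' (is_algaut_inv f)). Qed.

HB.instance Definition _ := isGroup.Build algAut
  algaut_mulA algaut_mul1 algaut_mulr1 algaut_mulV algaut_mulrV.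

End AlgebraAutomorphisms.

Section KoszulAut.
Variables (R : localRingType) (n : nat) (x : minGens R n).
Implicit Types phi psi : dgAut (koszul x).

Lemma hmap_algaut phi : is_algaut (hmap phi : koszulH x -> koszulH x).
Proof.
split; last by exists (hmap (dgaut_inv phi)); [exact: hmapK | exact: hmapVK].
  move=> u h k; rewrite hmapD; congr (_ + _).
  rewrite -[u]residueK -[h]hclassK.
  transitivity (hmap phi (hclass (repr u *: repr h))).
    by congr hmap; apply: koszulH_scaleE.
  rewrite !hmapE [RHS]koszulH_scaleE; congr (hclass _).
  by apply: val_inj; rewrite /= linearZ.
by split; [exact: hmap_1 | exact: hmapM].
Qed.

Definition Haut phi : algAut (koszulH x) := AlgAut (introT (asboolP _) (hmap_algaut phi)).

Definition induced_aut : {pred algAut (koszulH x)} :=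
  [pred f | `[< exists phi, f = Haut phi >]].

Lemma induced_aut_group_closed : group_closed induced_aut.
Proof.
split=> [|f g /asboolP[phi ->] /asboolP[psi ->]]; apply/asboolP.
  by exists (dgaut1 (koszul x)); apply: algaut_eq => h; rewrite /= hmap1.
exists (dgaut_comp phi (dgaut_inv psi)); apply: algaut_eq => h.
rewrite /= hmap_comp; congr (hmap phi _).
have [_ gK] := s2valP' (is_algaut_inv (Haut psi)).
by apply: (can_inj (@hmapK _ _ psi)); rewrite hmapVK; apply: gK.
Qed.

Record inducedAut : Type :=
  InducedAut { inducedaut_val :> algAut (koszulH x);
               inducedautP : inducedaut_val \in induced_aut }.

HB.instance Definition _ := [isSub for inducedaut_val].
HB.instance Definition _ := [Choice of inducedAut by <:].
HB.instance Definition _ := SubChoice_isSubGroup.Build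
  (algAut (koszulH x)) induced_aut inducedAut induced_aut_group_closed.

Lemma inducedAutE (f : koszulH x -> koszulH x) :
  (exists a : inducedAut, a =1 f) <-> (exists phi, hmap phi =1 f).
Proof.
split=> [[[a aA] af]|[phi fE]].
  by case/asboolP: (aA) => phi aE; exists phi => h; rewrite -af /= aE.
have aA : Haut phi \in induced_aut by apply/asboolP; exists phi.
by exists (InducedAut aA).
Qed.

Lemma inducedAutM (a b : inducedAut) (h : koszulH x) : (a * b)%g h = a (b h).
Proof. by []. Qed.

End KoszulAut.

Definition has_exponent (G : groupType) (m : nat) : Prop :=
  [/\ (0 < m)%N, forall g : G, (g ^+ m = 1)%g &
      forall l, (0 < l)%N -> (forall g : G, (g ^+ l = 1)%g) -> (m <= l)%N].

(* Main.v *)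
From HB Require Import structures.
Require Import Defs.
From mathcomp Require Import all_boot all_order all_algebra.
From mathcomp Require Import boolp ring.

(** Let e_i be the generators of the Koszul complex K, so that d e_i = x_i.
    A dg automorphism phi is determined by its displacements phi e_i - e_i,
    which are cycles of degree 1, and the induced action on H(K) depends only
    on their homology classes ([hmap_eq_of_exact]): when phi e_i - psi e_i is
    a boundary d u_i for each i, the u_i extend to a homotopy between phi and
    psi ([koszul_homotopy]).

    Minimality of the generators makes the coefficients of a cycle of degree 1
    lie in the maximal ideal m ([cycle_coeff_max_ideal]), and m annihilates
    H(K).  Hence every phi acts trivially on H_1(K) ([dgaut_fix_H1]): phi moves
    the sum of the c_j e_j by the sum of the c_j (phi e_j - e_j), a combination
    of cycles with coefficients in m.  It follows that displacement classes add
    up under composition ([displacement_comp]).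

    So the group of induced automorphisms is a homomorphic image of a subgroup
    of H_1(K)^n, a vector space over k: it is abelian, and it is killed by p
    when k has characteristic p. *)

Set Implicit Arguments.
Unset Strict Implicit.
Unset Printing Implicit Defensive.
Import GRing.Theory.
Local Open Scope ring_scope.

(** * Boundaries in a dg algebra *)

Section Exact.
Variables (R : comNzRingType) (A : dgAlgType R).
Implicit Types (a b : A) (phi psi : dgAut A).

Definition exact : {pred A} := [pred a | `[< exists b, a = dgdiff b >]].

Lemma exactP a : reflect (exists b, a = dgdiff b) (a \in exact).
Proof. exact: asboolP. Qed.

Lemma exact_zmod_closed : zmod_closed exact.
Proof.
split=> [|a b /exactP[a' ->] /exactP[b' ->]]; apply/exactP.
  by exists 0; rewrite linear0.
by exists (a' - b'); rewrite linearB.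
Qed.

HB.instance Definition _ := GRing.isZmodClosed.Build A exact exact_zmod_closed.

Lemma dgaut_exact phi a : a \in exact -> phi a \in exact.
Proof. by case/exactP=> b ->; apply/exactP; exists (phi b); rewrite dgaut_diff. Qed.

Lemma exact_homogeneous p a : a \in exact -> homogeneous p a ->
  exists2 b, homogeneous p.+1 b & a = dgdiff b.
Proof.
case/exactP=> b -> pdb; exists (dgproj p.+1 b); first exact: homogeneous_proj.
by rewrite dgdiff_projS pdb.
Qed.

Lemma homogeneousB p a b :
  homogeneous p a -> homogeneous p b -> homogeneous p (a - b).
Proof. by rewrite /homogeneous linearB /= => -> ->. Qed.

End Exact.

(** * Generators and contractions of the Koszul complex *)

Section Koszul.
Variables (R : comNzRingType) (n : nat) (x : 'I_n -> R).
Implicit Types (a : koszul x) (i j : 'I_n) (phi psi : dgAut (koszul x)).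

HB.instance Definition _ i := GRing.isLinear.Build R (exterior R n) (exterior R n)
  *:%R (@contract R n i) (@contract_linear R n i).

Definition kgen i : koszul x := extgen R i.

Definition kcontract i : koszul x -> koszul x := contract i.

HB.instance Definition _ i := GRing.Linear.on (kcontract i).

Lemma kgen_homogeneous i : homogeneous 1 (kgen i).
Proof.
by apply/extproj_id=> S; rewrite ffunE; case: (eqVneq S [set i]) => // ->; rewrite cards1.
Qed.

Lemma kgen_diff i : dgdiff (kgen i) = (x i)%:A.
Proof. exact: koszul_diff_gen. Qed.

Lemma kgen_diffM i a : dgdiff (kgen i * a) = x i *: a - kgen i * dgdiff a.
Proof.
by rewrite (dgdiffM 1 _ _ (kgen_homogeneous i)) kgen_diff mulr_algl expr1 mulN1r.
Qed.

Lemma kcontract_genM i j a :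
  kcontract j (kgen i * a) = (j == i)%:R *: a - kgen i * kcontract j a.
Proof.
rewrite [LHS](contractM j a (kgen_homogeneous i)) expr1 mulN1r contract_gen.
by rewrite scaler_nat mulr_natl.
Qed.

Lemma kcontract_diff i a : kcontract i (dgdiff a) = - dgdiff (kcontract i a).
Proof.
transitivity (contract i (koszul_diff x a)); first by [].
rewrite linear_sum [dgdiff _]/dgdiff /= /koszul_diff -sumrN; apply: eq_bigr => j _.
by rewrite linearZ /= contract_anti scalerN.
Qed.

(** The base case of the induction on the generators involved. *)
Lemma kcontract_free a : (forall i, kcontract i a = 0) -> a = (a set0 : R)%:A.
Proof.
move=> a0; apply/ffunP=> S; rewrite extZE ffunE.
have [->|[i iS]] := set_0Vmem S; first by rewrite eqxx mulr1.
have /ffunP/(_ (S :\ i)) := a0 i; rewrite !ffunE !inE eqxx /= setD1K // => E.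
rewrite -[LHS]mul1r -(extsign_sqr R [set i] (S :\ i)) -mulrA E mulr0.
by case: eqVneq iS => [->|_ _]; rewrite ?inE ?mulr0.
Qed.

Lemma koszul_deg1E a : homogeneous 1 a -> a = \sum_j (a [set j] : R) *: kgen j.
Proof.
move=> /extproj_id a1; apply/ffunP=> S; rewrite sum_ffunE.
have [/cards1P[j ->]|S1] := boolP (#|S| == 1%N).
  rewrite (bigD1 j) //= extZE ffunE eqxx mulr1 big1 ?addr0 // => l /negPf nlj.
  by rewrite extZE ffunE (inj_eq set1_inj) eq_sym nlj mulr0.
rewrite a1 // big1 // => j _; rewrite extZE ffunE.
by case: (eqVneq S [set j]) S1 => [->|_ _]; rewrite ?cards1 ?mulr0.
Qed.

Definition displacement phi i : koszul x := phi (kgen i) - kgen i.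

Lemma displacement_homogeneous phi i : homogeneous 1 (displacement phi i).
Proof.
by apply: homogeneousB (kgen_homogeneous i); apply/dgaut_deg/kgen_homogeneous.
Qed.

Lemma displacement_cycle phi i : dgdiff (displacement phi i) = 0.
Proof. by rewrite linearB /= -dgaut_diff kgen_diff linearZ /= rmorph1 subrr. Qed.

Section Homotopy.
Variables (phi psi : dgAut (koszul x)) (u : 'I_n -> koszul x).
Hypothesis u_homogeneous : forall i, homogeneous 2 (u i).
Hypothesis u_diff : forall i, phi (kgen i) - psi (kgen i) = dgdiff (u i).

(** The recursion forced by the rules h (e_i) = u_i and
    h (a * b) = h a * psi b + (-1)^|a| phi a * h b, reading a as
    (a - e_i * kcontract i a) + e_i * kcontract i a with both
    kcontract i a and a - e_i * kcontract i a free of e_i.  These rules are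
    in general incompatible with e_i ^ 2 = 0, so they are imposed for products
    taken in a fixed order only, here that of the list. *)
Fixpoint homotopy (s : seq 'I_n) a : koszul x :=
  if s is i :: s' then
    homotopy s' (a - kgen i * kcontract i a) + u i * psi (kcontract i a)
      - phi (kgen i) * homotopy s' (kcontract i a)
  else 0.

Lemma homotopy_linear s : linear (homotopy s).
Proof.
elim: s => [|i s IHs] r a b /=; first by rewrite scaler0 addr0.
rewrite !linearP /= !mulrDr -!scalerAr opprD addrACA -scalerBr !IHs.
by rewrite mulrDr -scalerAr opprD [X in X + _ = _]addrACA -scalerDr addrACA -scalerBr.
Qed.

HB.instance Definition _ s :=
  GRing.isLinear.Build R (koszul x) (koszul x) *:%R (homotopy s) (homotopy_linear s).

(** The induction adds one generator at a time: [homotopy s] is a homotopy on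
    the subcomplex of the elements that involve only the e_i with i in s. *)
Lemma koszul_homotopy_in s a : (forall j, j \notin s -> kcontract j a = 0) ->
  dgdiff (homotopy s a) + homotopy s (dgdiff a) = phi a - psi a.
Proof.
elim: s a => [|i s IHs] a a0.
  have -> : a = (a set0 : R)%:A by apply: kcontract_free => j; apply: a0.
  by rewrite /= linear0 addr0 !linearZ /= !rmorph1 scalerN subrr.
set b := kcontract i a; set c := a - kgen i * b.
have b0 j : j \notin s -> kcontract j b = 0.
  move=> js; have [->|nji] := eqVneq j i; first exact: contractxx.
  have := contract_anti j i a; rewrite -/(kcontract _ _) -/(kcontract _ _) => ->.
  rewrite -/(kcontract _ _) -/(kcontract _ _) a0 ?linear0 ?oppr0 //.
  by rewrite inE negb_or nji.
have c0 j : j \notin s -> kcontract j c = 0.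
  move=> js; rewrite linearB /= kcontract_genM (b0 _ js) mulr0 subr0.
  have [->|nji] := eqVneq j i; first by rewrite scale1r subrr.
  by rewrite scale0r subr0 a0 // inE negb_or nji.
have aE : a = c + kgen i * b by rewrite subrK.
have dbE : kcontract i (dgdiff a) = - dgdiff b by rewrite kcontract_diff.
have dcE : dgdiff a - kgen i * - dgdiff b = dgdiff c + x i *: b.
  by rewrite {1}aE linearD /= kgen_diffM mulrN opprK addrA subrK.
have phiE : phi a = phi c + phi (kgen i) * phi b by rewrite {1}aE rmorphD /= rmorphM.
have psiE : psi a = psi c + psi (kgen i) * psi b by rewrite {1}aE rmorphD /= rmorphM.
have phi1 : homogeneous 1 (phi (kgen i)) by apply/dgaut_deg/kgen_homogeneous.
have dphi : dgdiff (phi (kgen i)) = (x i)%:A.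
  by rewrite -dgaut_diff kgen_diff linearZ /= rmorph1.
rewrite /= -/b -/c dbE dcE linearB linearD /=.
rewrite (dgdiffM 2 _ _ (u_homogeneous i)) sqrrN expr1n mul1r.
rewrite (dgdiffM 1 _ _ phi1) dphi expr1 mulN1r mulr_algl.
have -> : homotopy s (dgdiff c + x i *: b) =
    homotopy s (dgdiff c) + x i *: homotopy s b.
  by rewrite linearD linearZ.
rewrite !linearN /= -dgaut_diff phiE psiE -u_diff.
have /(congr1 (fun y => y - homotopy s (dgdiff c))) := IHs c c0; rewrite addrK => ->.
have /(congr1 (fun y => y - homotopy s (dgdiff b))) := IHs b b0; rewrite addrK => ->.
rewrite !(mulrBr, mulrBl, mulrN, opprB, opprD, opprK) !addrA.
(* The parenthesized pairs are the terms that cancel. *)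
by rewrite [LHS](ACl (1*7*2*5*(11*3)*(4*8)*(6*13)*(12*10)*(14*9))%AC) /=
  !subrr !addr0.
Qed.

Lemma koszul_homotopy a :
  dgdiff (homotopy (enum 'I_n) a) + homotopy (enum 'I_n) (dgdiff a) = phi a - psi a.
Proof. by apply: koszul_homotopy_in => j; rewrite mem_enum. Qed.

End Homotopy.

(** The homotopy needs u_i of degree 2: this is where homogeneity of
    phi e_i - psi e_i enters, through [exact_homogeneous]. *)
Lemma hmap_eq_of_exact phi psi :
    (forall i, phi (kgen i) - psi (kgen i) \in @exact _ (koszul x)) ->
  hmap phi =1 hmap psi.
Proof.
move=> eqe h.
have /choice[u uP] i : exists b, homogeneous 2 b /\ phi (kgen i) - psi (kgen i) = dgdiff b.
  have [|b b2 bE] := exact_homogeneous (p := 1) (eqe i); last by exists b.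
  by apply: homogeneousB; apply/dgaut_deg/kgen_homogeneous.
rewrite -[h]hclassK !hmapE; apply/hclassP/boundaryP; rewrite cycle_valB /=.
exists (homotopy phi psi u (enum 'I_n) (cycle_val (repr h))).
rewrite -(koszul_homotopy (fun i => (uP i).1) (fun i => (uP i).2)).
by rewrite dgdiff_cycle linear0 addr0.
Qed.

End Koszul.

(** * Displacement classes and induced automorphisms *)

Section Displacements.
Variables (R : localRingType) (n : nat) (x : minGens R n).
Implicit Types (a b : koszul x) (phi psi : dgAut (koszul x)) (i j : 'I_n).

(** If the coefficient of x_j were a unit, x_j would lie in the span of the
    other generators, contradicting minimality. *)
Lemma relation_coeff_max_ideal (c : 'I_n -> R) :
  \sum_i c i * x i = 0 -> forall j, c j \in max_ideal R.
Proof.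
move=> c0 j; rewrite inE; apply/negP=> cj.
apply: (@mingens_min _ _ x (setT :\ j) _ _); first by apply: properD1; rewrite inE.
move=> r; split=> [/(mingens_gen x)[d ->]|[d ->]]; last first.
  apply/(mingens_gen x); exists (fun i => if i == j then 0 else d i).
  rewrite [RHS](bigD1 j) ?inE //= eqxx mul0r add0r.
  apply: eq_big => i; first by rewrite !inE andbT.
  by rewrite !inE andbT => /negPf->.
(* Solve the relation for x_j, then substitute in a combination of the x_i. *)
have xj : x j = - (c j)^-1 * \sum_(i in setT :\ j) c i * x i.
  apply: (mulrI cj); rewrite mulNr mulrN mulVKr // -[LHS]subr0.
  rewrite -[X in _ - X]c0 (bigD1 j) //= opprD addNKr; congr (- _).
  by apply: eq_bigl => i; rewrite !inE andbT.
exists (fun i => d i - d j * (c j)^-1 * c i).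
rewrite (bigD1 j) ?inE //= {1}xj mulr_sumr mulr_sumr.
rewrite [X in _ + X](_ : _ = \sum_(i in setT :\ j) d i * x i); last first.
  by apply: eq_bigl => i; rewrite !inE andbT.
by rewrite -big_split /=; apply: eq_bigr => i _; ring.
Qed.

Lemma cycle_coeff_max_ideal a : homogeneous 1 a -> dgdiff a = 0 ->
  forall j, (a [set j] : R) \in max_ideal R.
Proof.
move=> a1 da; apply: (relation_coeff_max_ideal (c := fun i => a [set i])).
have : (\sum_i (a [set i] : R) * x i)%:A = 0 :> koszul x.
  rewrite -[RHS]da [in RHS](koszul_deg1E a1) linear_sum scaler_suml.
  by apply: eq_bigr => i _; rewrite linearZ /= kgen_diff scalerA.
by move/ffunP/(_ set0); rewrite extZE !ffunE eqxx mulr1.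
Qed.

Lemma max_ideal_exact (r : R) a :
  r \in max_ideal R -> dgdiff a = 0 -> r *: a \in @exact _ (koszul x).
Proof.
move=> rm /eqP da; have /boundaryP[b bE] := max_ideal_boundary (Cycle da) rm.
by apply/exactP; exists b.
Qed.

(** The action on H_1(K) is trivial: for a = sum of the c_j e_j, the difference
    phi a - a is the sum of the c_j (phi e_j - e_j), where c_j is in the maximal
    ideal and phi e_j - e_j is a cycle. *)
Lemma dgaut_fix_H1 phi a : homogeneous 1 a -> dgdiff a = 0 ->
  phi a - a \in @exact _ (koszul x).
Proof.
move=> a1 da; rewrite {1 2}(koszul_deg1E a1) linear_sum -sumrB.
apply: rpred_sum => j _; rewrite linearZ /= -scalerBr.
by apply: max_ideal_exact (displacement_cycle phi j); apply: cycle_coeff_max_ideal.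
Qed.

(** The defect of additivity is phi (psi e_i - e_i) - (psi e_i - e_i), which is
    a boundary because phi acts trivially on H_1(K). *)
Lemma displacement_comp phi psi i :
  displacement (dgaut_comp phi psi) i - (displacement phi i + displacement psi i)
    \in @exact _ (koszul x).
Proof.
have -> : displacement (dgaut_comp phi psi) i
    - (displacement phi i + displacement psi i)
  = phi (displacement psi i) - displacement psi i.
  by rewrite /displacement /= linearB /= opprD opprB !addrA subrK.
by apply: dgaut_fix_H1; [apply: displacement_homogeneous | apply: displacement_cycle].
Qed.

Lemma hmap_eq_of_displacement phi psi :
    (forall i, displacement phi i - displacement psi i \in @exact _ (koszul x)) ->
  hmap phi =1 hmap psi.
Proof.
move=> H; apply: hmap_eq_of_exact => i; have := H i.
by rewrite /displacement opprB addrA subrK.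
Qed.

Lemma inducedAut_lift (g : inducedAut x) : exists phi, g =1 hmap phi.
Proof.
by case: g => g gA; case/asboolP: (gA) => phi gE; exists phi => h; rewrite /= gE.
Qed.

Lemma inducedAut_eq (f g : inducedAut x) : f =1 g -> f = g.
Proof. by move=> fg; apply/val_inj/algaut_eq. Qed.

Lemma inducedAut_comm (f g : inducedAut x) : (f * g = g * f)%g.
Proof.
have [phi fE] := inducedAut_lift f; have [psi gE] := inducedAut_lift g.
apply: inducedAut_eq => h; rewrite !inducedAutM !fE !gE -!hmap_comp.
apply: hmap_eq_of_displacement => i.
have := rpredB (displacement_comp phi psi i) (displacement_comp psi phi i).
by rewrite [displacement psi i + _]addrC opprB addrA subrK.
Qed.

Lemma inducedAut_expg_lift (g : inducedAut x) phi m : g =1 hmap phi ->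
  exists2 psi, (g ^+ m)%g =1 hmap psi &
    forall i, displacement psi i - displacement phi i *+ m \in @exact _ (koszul x).
Proof.
move=> gE; elim: m => [|m [psi gmE psiE]].
  exists (dgaut1 (koszul x)) => [h|i]; first by rewrite hmap1.
  by rewrite /displacement /= subrr subr0 rpred0.
exists (dgaut_comp phi psi) => [h|i].
  by rewrite expgS inducedAutM gmE gE hmap_comp.
have := rpredD (displacement_comp phi psi i) (psiE i).
move: (displacement _ i) (displacement phi i) (displacement psi i) => u v w.
by rewrite mulrS !opprD !addrA subrK.
Qed.

(** The displacements of a lift of g ^+ p are p times those of a lift of g, up
    to boundaries, and p lies in the maximal ideal. *)
Lemma inducedAut_expg_pchar (p : nat) (g : inducedAut x) :
  p \in [pchar residue_field R] -> (g ^+ p = 1)%g.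
Proof.
move=> pk; have [phi gE] := inducedAut_lift g.
have [psi gpE psiE] := inducedAut_expg_lift p gE.
apply: inducedAut_eq => h; rewrite gpE -[RHS](hmap1 (A := koszul x)).
apply: hmap_eq_of_displacement => i.
have pm : p%:R \in max_ideal R.
  rewrite -[p%:R]subr0; apply/residueP; rewrite residue0 -(pcharf0 pk).
  by elim: (p) => [|m IHm]; rewrite ?residue0 // !mulrS residueD residue1 IHm.
have := max_ideal_exact pm (displacement_cycle phi i); rewrite scaler_nat.
move/(rpredD (psiE i)); rewrite subrK => E.
by rewrite [displacement (dgaut1 _) i]subrr subr0.
Qed.

End Displacements.

(** If also g ^+ l = 1 for all g, with 0 < l < p, then a Bezout relation between
    l and p makes every g trivial. *)
Lemma has_exponent_prime (G : groupType) (p : nat) : prime p ->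
  (forall g : G, (g ^+ p = 1)%g) -> (forall g : G, g = 1%g) \/ has_exponent G p.
Proof.
move=> p_pr Gp; have [G1|nG1] := pselect (forall g : G, g = 1%g); first by left.
right; split=> // [|l l0 Gl]; first exact: prime_gt0.
rewrite leqNgt; apply/negP=> lp; apply: nG1 => g.
have /coprimeP : coprime p l by rewrite prime_coprime // gtnNdvd.
move=> /(_ (prime_gt0 p_pr))[[a b] /= ab].
have {}ab : (a * p = b * l + 1)%N.
  by rewrite -ab subnKC // ltnW // -subn_gt0 ab.
have := expgnA g p a; rewrite mulnC ab mulnC expgnDr expgnA Gl Gp.
by rewrite !expg1n mul1g.
Qed.

Theorem theorem1p2 (R : noethLocalRingType) (n : nat) (x : minGens R n) :
  (forall a b : inducedAut x, (a * b = b * a)%g) /\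
  (forall p : nat, p \in [pchar (residue_field R)]%R ->
     (forall a : inducedAut x, a = 1%g) \/ has_exponent (inducedAut x) p).
Proof.
split=> [a b|p pk]; first exact: inducedAut_comm.
by apply: has_exponent_prime (pcharf_prime pk) _ => g; apply: inducedAut_expg_pchar.
Qed.
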